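(* Let $H = (V, A, B)$ be a critical cross-intersecting family, and let $n := \max_{e \in A \cup B} |e|$ be the (finite) maximum size of an edge. Then $\max(|A|, |B|) \leq n^n$.
   Context: A hypergraph is a pair $(V,E)$ where $V$ is a set of vertices and $E$ is a set of subsets of $V$ (edges). A cross-intersecting family $H = (V, A, B)$ is a hypergraph with vertex set $V$ and edge set $A \cup B$, where $A$ and $B$ are non-empty (not necessarily disjoint) sets of edges such that $a \cap b \neq \emptyset$ for every $a \in A$ and $b \in B$. A cross-intersecting family $(V,A,B)$ is called critical if (i) for any edge $a \in A$ and any $v \in a$ there is $b \in B$ such that $a \cap b = \{v\}$, and (ii) for any edge $b \in B$ and any $v \in b$ there is $a \in A$ such that $a \cap b = \{v\}$. *)

(* Defs.v *)
From mathcomp Require Import all_boot.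
From mathcomp Require Import boolp classical_sets functions cardinality.

Set Implicit Arguments.
Unset Strict Implicit.
Unset Printing Implicit Defensive.

Local Open Scope classical_set_scope.
Local Open Scope card_scope.

(* The vertex set is a whole type [V], possibly infinite, and edges are
   arbitrary subsets of [V].  The edge set of the family is [A `|` B]. *)
Definition cross_intersecting (V : Type) (A B : set (set V)) : Prop :=
  [/\ A !=set0, B !=set0
    & forall a b : set V, A a -> B b -> a `&` b !=set0].

Definition critical (V : Type) (A B : set (set V)) : Prop :=
  (forall (a : set V) (v : V), A a -> a v ->
     exists2 b : set V, B b & a `&` b = [set v]) /\
  (forall (b : set V) (v : V), B b -> b v ->
     exists2 a : set V, A a & a `&` b = [set v]).

(* [n] is the maximum of |e| over [e] in [E]; since [`I_n] is the finite set
   {0, ..., n-1}, this forces every member of [E] to be finite. *)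
Definition max_edge_size (V : Type) (E : set (set V)) (n : nat) : Prop :=
  (exists2 e : set V, E e & e #= `I_n) /\
  (forall e : set V, E e -> e #<= `I_n).

(* Main.v *)
(* Only the minimality condition on one side matters: a transversal [P] of [B]
   contained in [a \in A] must be equal to [a].  Grow [P] from the empty set: as
   long as some [b \in B] misses [P], every [a] containing [P] also contains one
   of the at most [n] points of [b].  This is a tree of branching at most [n]
   and depth at most [n] whose leaves are the members of [A]. *)
Require Import Defs.
From mathcomp Require Import all_boot.
From mathcomp Require Import boolp classical_sets functions cardinality.

Local Open Scope classical_set_scope.
Local Open Scope card_scope.

Lemma card_le_setD1 (T : Type) (X : set T) (x : T) (k : nat) :
  X x -> X #<= `I_k.+1 -> X `\ x #<= `I_k.
Proof.
move=> Xx Xk; have finX : finite_set X by apply/finite_set_leP; exists k.+1.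
have /finite_setP[m Xxm] : finite_set (X `\ x) by apply: finite_setD.
have Xm : X #= `I_m.+1 by apply/eq_cardSP; exists x.
by rewrite (card_le_eql Xxm) card_le_II -ltnS -card_le_II -(card_le_eql Xm).
Qed.

Lemma card_le_bigcup (I T : Type) (D : set I) (F : I -> set T) (p q : nat) :
  D #<= `I_p -> (forall i, D i -> F i #<= `I_q) ->
  \bigcup_(i in D) F i #<= `I_(p * q).
Proof.
(* The enumerations below are total functions on [nat], so empty types are split off first. *)
elim/Ppointed: T => T in F *; first by rewrite empty_eq0.
elim/Ppointed: I => I in D F *; first by rewrite (empty_eq0 D) bigcup_set0.
move=> /pcard_surjP[h hD] Fq.
have /choice[g gF] :
    forall i, exists g : nat -> T, D i -> set_surj `I_q (F i) g.
  move=> i; have [Di|nDi] := pselect (D i); last by exists (fun=> point).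
  by have /pcard_surjP[g gF] := Fq i Di; exists g.
(* Division with remainder by [q]: the quotient selects the index, the remainder the element of its
   set. *)
apply/pcard_surjP; exists (fun k => g (h (k %/ q)) (k %% q)) => y [i Di Fiy].
have [u /= ltup hu] := hD i Di; have [v /= ltvq gv] := gF i Di y Fiy.
have q_gt0 : 0 < q by apply: leq_ltn_trans ltvq.
exists (u * q + v) => /=.
  by rewrite -ltn_divLR// divnMDl// divn_small// addn0.
by rewrite divnMDl// modnMDl divn_small// modn_small// addn0 hu gv.
Qed.

Section Extensions.
Variables (V : Type) (A B : set (set V)) (n : nat).
Hypothesis crossAB : forall a b, A a -> B b -> a `&` b !=set0.
Hypothesis critA : forall (a : set V) (v : V), A a -> a v ->
  exists2 b : set V, B b & a `&` b = [set v].

(** Each [v] in [a] is the only common point of [a] and some [b]; since [P] meets [b] inside [a], it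
    must do so at [v]. *)
Lemma transversal_sub_eq (P a : set V) :
  (forall b, B b -> P `&` b !=set0) -> A a -> P `<=` a -> a = P.
Proof.
move=> PB Aa Pa; apply/seteqP; split=> // v av.
have [b Bb abv] := critA _ _ Aa av; have [w [Pw bw]] := PB b Bb.
have : (a `&` b) w by split=> //; apply: Pa.
by rewrite abv => /= <-.
Qed.

(** Counts the leaves below the node [P], with [k] bounding the remaining depth; the induction on
    [k] needs all [P] at once, as [P] grows. *)
Lemma card_le_extensions (k : nat) (P : set V) :
  B !=set0 -> (forall b, B b -> b #<= `I_n) ->
  (forall a, A a -> P `<=` a -> a `\` P #<= `I_k) ->
  [set a | A a /\ P `<=` a] #<= `I_(n ^ k).
Proof.
move=> [b0 Bb0] Bn; elim: k P => [|k IHk] P Pk.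
  apply: (@card_le_trans _ _ _ [set P]); last first.
    by rewrite (card_le_eql card_set1).
  apply: subset_card_le => a [Aa Pa] /=; apply/seteqP; split=> //.
  by have := Pk a Aa Pa; rewrite II0 => /card_le0P; rewrite setD_eq0.
have [PB|] := pselect (forall b, B b -> P `&` b !=set0).
  apply: (@card_le_trans _ _ _ [set P]).
    by apply: subset_card_le => a [Aa Pa]; apply: transversal_sub_eq.
  (* One leaf fits unless [n] is 0; but then [b0] would be empty, while [P] meets it. *)
  rewrite (card_le_eql card_set1) card_le_II expn_gt0.
  case: posnP => // n0; have [v [_ b0v]] := PB b0 Bb0.
  by have := Bn b0 Bb0; rewrite n0 II0 => /card_le0P b00; rewrite b00 in b0v.
move=> /existsNP[b /not_implyP[Bb /set0P/negP/negPn/eqP Pb0]].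
(* Branch over the points of the missed edge [b]: any [a] containing [P] meets [b]. *)
apply: (@card_le_trans _ _ _
    (\bigcup_(v in b) [set a | A a /\ (v |` P) `<=` a])).
  apply: subset_card_le => a [Aa Pa]; have [v [av bv]] := crossAB _ _ Aa Bb.
  by exists v => //; split=> // w [->|/Pa].
rewrite expnS; apply: card_le_bigcup; first exact: Bn.
move=> v bv; apply: IHk => a Aa vPa.
(* The new point [v] lies in [a] but not in [P], so adding it lowers the depth by one. *)
rewrite setUC -setDDl; apply: card_le_setD1.
  split; first by apply: vPa; left.
  by move=> Pv; have : (P `&` b) v by []; rewrite Pb0.
by apply: Pk => // w Pw; apply: vPa; right.
Qed.

Lemma card_le_critical_side :
  B !=set0 -> (forall e, (A `|` B) e -> e #<= `I_n) -> A #<= `I_(n ^ n).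
Proof.
(* The root of the tree is [set0], with depth [n] because edges of [A] have at most [n] points. *)
move=> B0 ABn; apply: (@card_le_trans _ _ _ [set a | A a /\ set0 `<=` a]).
  by apply: subset_card_le => a Aa; split=> //; apply: sub0set.
apply: card_le_extensions => // [b Bb|a Aa _]; first by apply: ABn; right.
by rewrite setD0; apply: ABn; left.
Qed.

End Extensions.

Theorem theorem1p10 (V : Type) (A B : set (set V)) (n : nat)
    (hcross : cross_intersecting A B) (hcrit : critical A B)
    (hn : max_edge_size (A `|` B) n) :
  A #<= `I_(n ^ n) /\ B #<= `I_(n ^ n).
Proof.
case: hcross hcrit hn => A0 B0 crossAB [critA critB] [_ ABn].
split; first exact: (@card_le_critical_side V A B).
apply: (@card_le_critical_side V B A) => //.
- by move=> b a Bb Aa; rewrite setIC; apply: crossAB.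
- move=> b v Bb bv; have [a Aa abv] := critB b v Bb bv.
  by exists a; rewrite 1?setIC.
- by rewrite setUC.
Qed.
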